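(* Let $N\in\mathbb{N}$, let $\Omega\subset\mathbb{R}^N$ be a bounded domain, and let $p,q\in[1,\infty]$ with $q\le p$. Suppose that there exist finitely many bounded domains $\Omega_1,\dots,\Omega_n$ satisfying $\overline{\Omega}=\bigcup_{1\le i\le n}\overline{\Omega_i}$ and $\Omega_i\cap\Omega_j=\emptyset$ for $i\ne j$. Suppose moreover that for every $i\in\{1,\dots,n\}$ there is a constant $D_p(\Omega_i)$ such that $$\|u-u_{\Omega_i}\|_{L^p(\Omega_i)}\le D_p(\Omega_i)\,\|\nabla u\|_{L^q(\Omega_i)}\quad\text{for all }u\in W^{1,q}(\Omega_i).$$ Then $$\|u\|_{L^p(\Omega)}\le C_p(\Omega)\,\|u\|_{W^{1,q}(\Omega)}\quad\text{for all }u\in W^{1,q}(\Omega)$$ holds with $$C_p(\Omega)=2^{1-\frac1q}\max\left(\max_{1\le i\le n}|\Omega_i|^{\frac1p-\frac1q},\ \max_{1\le i\le n}D_p(\Omega_i)\right),$$ where this formula is understood with $1/\infty=0$ when $p=\infty$ and/or $q=\infty$.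
   Context: A domain is a nonempty connected open set, and $\overline{S}$ denotes the closure of $S$. $|S|$ denotes the Lebesgue measure of $S$ and $u_S=|S|^{-1}\int_S u(x)\,dx$ is the mean of $u$ over $S$. Functions are real-valued, $\nabla u$ is the weak gradient, $|\nabla u|$ its pointwise Euclidean norm, and $\|\nabla u\|_{L^q(S)}:=\||\nabla u|\|_{L^q(S)}$. The Sobolev norm is $\|u\|_{W^{1,q}(S)}=\left(\int_S|u|^q\,dx+\int_S|\nabla u|^q\,dx\right)^{1/q}$ if $1\le q<\infty$, and $\|u\|_{W^{1,\infty}(S)}=\operatorname{ess\,sup}_S|u|+\operatorname{ess\,sup}_S|\nabla u|$.
   Formalization: It is additionally assumed that every Ω_i is contained in Ω and that Ω minus the union of the Ω_i has Lebesgue measure zero; with the closure condition alone the claim fails (e.g. Ω a square minus a slit that almost encloses a small square, Ω_1 the full square). *)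

(* Defs.v *)
From HB Require Import structures.
From mathcomp Require Import all_boot all_order all_algebra.
From mathcomp Require Import all_classical all_reals all_analysis.
From mathcomp Require Import measurable_realfun.

Set Implicit Arguments.
Unset Strict Implicit.
Unset Printing Implicit Defensive.
Import Order.TTheory GRing.Theory Num.Theory.
Import numFieldNormedType.Exports.
Local Open Scope classical_set_scope.
Local Open Scope ring_scope.

(* R^N is 'rV[R]_N with its Borel sigma-algebra. *)
Definition borel_rV_display : measure_display.
Proof. by constructor. Qed.

Section borel_rV.
Context {R : realType} (n : nat).

Let borel0 : <<s @open 'rV[R]_n >> set0.
Proof. exact: sigma_algebra0. Qed.

Let borelC A : <<s @open 'rV[R]_n >> A -> <<s @open 'rV[R]_n >> (~` A).
Proof. exact: sigma_algebraC. Qed.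

Let borelU (F : (set 'rV[R]_n)^nat) : (forall i, <<s @open 'rV[R]_n >> (F i)) ->
  <<s @open 'rV[R]_n >> (\bigcup_i (F i)).
Proof. exact: sigma_algebra_bigcup. Qed.

HB.instance Definition _ := @isMeasurable.Build borel_rV_display
  'rV[R]_n (<<s @open 'rV[R]_n >>) borel0 borelC borelU.

End borel_rV.

Section borel_rV_theory.
Context {R : realType}.

Lemma open_measurable_rV n (A : set 'rV[R]_n) : open A -> measurable A.
Proof. exact: sub_sigma_algebra. Qed.

Lemma measurable_coord n (i : 'I_n) :
  measurable_fun [set: 'rV[R]_n] (fun v : 'rV[R]_n => v ord0 i).
Proof.
apply: (measurability _ (RGenOInfty.measurableE R)).
move=> _ [_ [a ->] <-]; rewrite setTI; apply: open_measurable_rV.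
apply: open_comp; last exact: interval_open.
by move=> v _; exact: coord_continuous.
Qed.

Lemma measurable_fun_rV d (T : measurableType d) n (f : T -> 'rV[R]_n) :
  (forall i, measurable_fun [set: T] (fun x => f x ord0 i)) ->
  measurable_fun [set: T] f.
Proof.
move=> mf; apply: (measurability (@open 'rV[R]_n) erefl).
move=> _ [U oU <-]; rewrite setTI.
pose box (qk : 'rV[rat]_n * nat) : set 'rV[R]_n :=
  ball (map_mx ratr qk.1 : 'rV[R]_n) qk.2.+1%:R^-1.
have UE : U = \bigcup_(qk in [set qk | box qk `<=` U]) box qk.
  apply/seteqP; split => [x Ux|x [qk + bx]]; last exact.
  have /nbhs_ballP[e /= e0 eU] : nbhs x U by exact: open_nbhs_nbhs.
  have e20 : 0 < e / 2 by rewrite divr_gt0.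
  have [k ke] : exists k, k.+1%:R^-1 < e / 2 :> R.
    by have /filter_ex[k] := near_infty_natSinv_lt (PosNum e20); exists k.
  have k0 : 0 < k.+1%:R^-1 :> R by rewrite invr_gt0.
  have /choice[q qE] : forall i : 'I_n, exists q : rat,
      `|ratr q - x ord0 i| < k.+1%:R^-1.
    move=> i; have [q] : exists q,
        ratr q \in `](x ord0 i - k.+1%:R^-1), (x ord0 i + k.+1%:R^-1)[.
      by apply: rat_in_itvoo; rewrite ltrD2l (@lt_trans _ _ 0)// oppr_lt0.
    by rewrite in_itv/= => qq; exists q; rewrite ltr_distl.
  have bx : box (\row_i q i, k) x.
    split=> [|i j]; first exact: k0.
    by rewrite !mxE (ord1 i); exact: qE.
  exists (\row_i q i, k) => //= y by'; apply: eU.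
  apply: (@ball_split _ _ (map_mx ratr (\row_i q i) : 'rV[R]_n)).
    by apply: ball_sym; apply: le_ball bx; exact: ltW.
  by apply: le_ball by'; exact: ltW.
rewrite UE preimage_bigcup bigcup_mkcond.
apply: countable_bigcupT_measurable; first exact: countableP.
move=> qk; case: ifPn => // _.
have -> : f @^-1` box qk = \bigcap_(i in [set: 'I_n])
    ((fun x => f x ord0 i) @^-1` ball (ratr (qk.1 ord0 i) : R) qk.2.+1%:R^-1).
  apply/seteqP; split => [x [_ xb] i _|x xb].
    by have := xb ord0 i; rewrite mxE.
  split; first by rewrite invr_gt0.
  by move=> i j; rewrite (ord1 i) mxE; exact: xb.
apply: fin_bigcap_measurable => // i _.
rewrite -[X in measurable X]setTI; apply: mf => //.
by apply: open_measurable; exact: ball_open.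
Qed.

End borel_rV_theory.

Section lebesgue_rV.
Context {R : realType}.

Definition consrV n (xv : R * 'rV[R]_n) : 'rV[R]_n.+1 :=
  row_mx (xv.1%:M : 'rV[R]_1) xv.2.

Lemma consrV0 n (xv : R * 'rV[R]_n) : consrV xv ord0 ord0 = xv.1.
Proof.
have -> : ord0 = lshift n ord0 :> 'I_(1 + n) by exact: val_inj.
by apply: etrans (row_mxEl _ _ _ _) _; rewrite mxE eqxx mulr1n.
Qed.

Lemma consrVS n (xv : R * 'rV[R]_n) i :
  consrV xv ord0 (lift ord0 i) = xv.2 ord0 i.
Proof.
have -> : lift ord0 i = rshift 1 i by exact: val_inj.
exact: row_mxEr.
Qed.

Lemma measurable_consrV n : measurable_fun [set: R * 'rV[R]_n] (@consrV n).
Proof.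
apply: measurable_fun_rV => i; have [j|] := unliftP ord0 i => ->.
  rewrite [X in measurable_fun _ X](_ : _ = (fun v : 'rV[R]_n => v ord0 j) \o snd).
    by apply: measurableT_comp (measurable_coord j) _; exact: measurable_snd.
  by apply/funext => x; exact: consrVS.
rewrite [X in measurable_fun _ X](_ : _ = fst); first exact: measurable_fst.
by apply/funext => x; exact: consrV0.
Qed.

Definition unconsrV n (v : 'rV[R]_n.+1) : R * 'rV[R]_n :=
  (v ord0 ord0, @rsubmx _ 1 1 n v).

Lemma measurable_unconsrV n : measurable_fun [set: 'rV[R]_n.+1] (@unconsrV n).
Proof.
apply/measurable_fun_pairP; split; first exact: measurable_coord.
apply: measurable_fun_rV => i.
rewrite [X in measurable_fun _ X](_ : _ = fun v : 'rV[R]_(1 + n) => v ord0 (rshift 1 i)).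
  exact: measurable_coord.
by apply/funext => v; rewrite /= mxE.
Qed.

Lemma consrVK n : cancel (@consrV n) (@unconsrV n).
Proof.
by move=> [x v]; congr pair; [exact: consrV0|exact: row_mxKr].
Qed.

Section step.
Variables (n : nat) (mu : {sigma_finite_measure set 'rV[R]_n -> \bar R}).
Local Open Scope ereal_scope.

Definition lebesgue_step : set 'rV[R]_n.+1 -> \bar R :=
  pushforward (@lebesgue_measure R \x mu) (@consrV n).

Let m : {measure set 'rV[R]_n.+1 -> \bar R} :=
  measure_function_pushforward__canonical__measure_function_Measure
    (@lebesgue_measure R \x mu) (@measurable_consrV n).

HB.instance Definition _ := isMeasure.Build _ _ _ lebesgue_step
  (measure0 m) (measure_ge0 m) (@measure_semi_sigma_additive _ _ _ m).

Let step_sigma_finite : sigma_finite setT lebesgue_step.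
Proof.
have /sigma_finiteP[F [FT ndF Foo]] := sigma_finiteT (@lebesgue_measure R).
have /sigma_finiteP[G [GT ndG Goo]] := sigma_finiteT mu.
exists (fun k => @unconsrV n @^-1` (F k `*` G k)).
  rewrite -preimage_bigcup (_ : \bigcup_k _ = setT) ?preimage_setT//.
  apply/seteqP; split => // -[x v] _.
  have [i _ Fx] : (\bigcup_k F k) x by rewrite -FT.
  have [j _ Gv] : (\bigcup_k G k) v by rewrite -GT.
  exists (maxn i j) => //; split => /=.
    by move: Fx; exact/subsetPset/ndF/leq_maxl.
  by move: Gv; exact/subsetPset/ndG/leq_maxr.
move=> k; have [mF Fk] := Foo k; have [mG Gk] := Goo k.
have mFG : measurable (F k `*` G k) by exact: measurableX.
split; first by rewrite -[X in measurable X]setTI; exact: measurable_unconsrV.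
rewrite /lebesgue_step /pushforward -comp_preimage.
rewrite (_ : _ \o _ = id) ?preimage_id; last exact/funext/consrVK.
rewrite product_measure1E// lte_mul_pinfty// ge0_fin_numE//.
Qed.

HB.instance Definition _ := Measure_isSigmaFinite.Build _ _ _ lebesgue_step
  step_sigma_finite.

End step.

(* Lebesgue measure on R^(k+1) is the product of that on R with that on R^k;
   lebesgue_rV_box below gives the volume of a box. *)
Fixpoint lebesgue_rV n : {sigma_finite_measure set 'rV[R]_n -> \bar R} :=
  match n with
  | 0 => \d_(0 : 'rV[R]_0)
  | k.+1 => lebesgue_step (lebesgue_rV k)
  end.

Lemma measurable_pi n (A : 'I_n -> set R) : (forall i, measurable (A i)) ->
  measurable [set v : 'rV[R]_n | forall i, A i (v ord0 i)].
Proof.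
move=> mA; have -> : [set v : 'rV[R]_n | forall i, A i (v ord0 i)] =
    \bigcap_(i in [set: 'I_n]) ((fun v : 'rV[R]_n => v ord0 i) @^-1` A i).
  by apply/seteqP; split => v /= Av i; [move=> _|]; exact: Av.
apply: fin_bigcap_measurable => // i _.
by rewrite -[X in measurable X]setTI; exact: measurable_coord.
Qed.

Lemma lebesgue_rV_pi n (A : 'I_n -> set R) : (forall i, measurable (A i)) ->
  lebesgue_rV n [set v | forall i, A i (v ord0 i)] =
  (\prod_(i < n) @lebesgue_measure R (A i))%E.
Proof.
elim: n A => [|n IH] A mA.
  by rewrite big_ord0 /= diracE mem_set// => -[].
have mA' : measurable [set v : 'rV[R]_n | forall i, A (lift ord0 i) (v ord0 i)].
  exact: (@measurable_pi n (fun i => A (lift ord0 i))).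
rewrite big_ord_recl -(IH (fun i => A (lift ord0 i)) (fun i => mA _))/=.
rewrite -product_measure1E//; last exact: (mA ord0).
rewrite /lebesgue_step /pushforward; congr (_ _).
apply/seteqP; split => [xv/= Axv|xv/= [Ax Av] i].
  split=> [|i]; first by have := Axv ord0; rewrite consrV0.
  by have := Axv (lift ord0 i); rewrite consrVS.
by have [j|] := unliftP ord0 i => ->; rewrite ?consrVS ?consrV0.
Qed.

Lemma lebesgue_rV_box n (a b : 'rV[R]_n) : (forall i, a ord0 i <= b ord0 i) ->
  lebesgue_rV n [set v | forall i, a ord0 i <= v ord0 i <= b ord0 i] =
  (\prod_(i < n) (b ord0 i - a ord0 i))%:E.
Proof.
move=> ab.
have boxE : [set v : 'rV[R]_n | forall i, a ord0 i <= v ord0 i <= b ord0 i] =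
    [set v | forall i, `[a ord0 i, b ord0 i]%classic (v ord0 i)].
  by apply/seteqP; split => v /= + i => /(_ i); rewrite in_itv.
apply: (etrans (congr1 (lebesgue_rV n) boxE)).
apply: (etrans (@lebesgue_rV_pi n (fun i => `[a ord0 i, b ord0 i]%classic) _)) => //.
rewrite -prodEFin; apply: eq_bigr => i _.
rewrite lebesgue_measure_itv/= lte_fin; case: ltgtP (ab i) => // -> _.
by rewrite subrr.
Qed.

End lebesgue_rV.

Section sobolev.
Context {R : realType} {N : nat}.
Local Notation V := 'rV[R]_N.
Local Notation mu := (@lebesgue_rV R N).
Implicit Types (S : set V) (p q : \bar R) (u phi : V -> R) (Du : V -> V).

Definition domain S := [/\ S !=set0, connected S & open S].

(* The library norm on 'rV[R]_N is the sup norm. *)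
Definition euclidean_norm (v : V) : R := Num.sqrt (\sum_i v ord0 i ^+ 2).

Definition partial (i : 'I_N) phi : V -> R := 'D_(delta_mx ord0 i) phi.

Fixpoint Ck (k : nat) phi : Prop :=
  match k with
  | 0 => continuous phi
  | k'.+1 => continuous phi /\ forall i,
      (forall x, derivable phi x (delta_mx ord0 i)) /\ Ck k' (partial i phi)
  end.

Definition supp phi : set V := closure [set x | phi x != 0].

Definition test_function S phi :=
  [/\ forall k, Ck k phi, compact (supp phi) & supp phi `<=` S].

Definition locally_integrable_on S u :=
  measurable_fun S u /\
  forall K, compact K -> K `<=` S -> mu.-integrable K (EFin \o u).

Definition weak_gradient S u Du :=
  [/\ locally_integrable_on S u,
      forall i, locally_integrable_on S (fun x => Du x ord0 i) &
      forall phi i, test_function S phi ->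
        \int[mu]_(x in S) (u x * partial i phi x) =
        - \int[mu]_(x in S) (Du x ord0 i * phi x)].

(* For p = +oo this is the essential supremum of |u| 1_S over R^N, which is the
   essential supremum of |u| over S whenever S is open and nonempty. *)
Definition Lp_norm S p u : \bar R := 'N[mu]_p[(EFin \o u) \_ S].

Definition in_Lp S p u := measurable_fun S u /\ (Lp_norm S p u < +oo)%E.

(* u belongs to W^{1,q}(S) and Du represents its weak gradient on S; since the
   latter is determined up to a null set, the norms below do not depend on
   which representative Du is used. *)
Definition sobolev S q u Du :=
  [/\ in_Lp S q u, weak_gradient S u Du & in_Lp S q (euclidean_norm \o Du)].

(* The value at -oo is irrelevant. *)
Definition sobolev_norm S q u Du : \bar R :=
  match q with
  | r%:E => (\int[mu]_(x in S) (`|u x| `^ r)%:E +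
             \int[mu]_(x in S) (euclidean_norm (Du x) `^ r)%:E) `^ r^-1
  | _ => Lp_norm S +oo u + Lp_norm S +oo (euclidean_norm \o Du)
  end%E.

Definition mean S u : R := (fine (mu S))^-1 * \int[mu]_(x in S) u x.

(* In \bar R the inverse of +oo is 0, so that fine p^-1 is 1/p with the
   convention 1/oo = 0; -oo is the neutral element of maxe. *)
Definition embedding_constant n (p q : \bar R) (O : 'I_n -> set V)
    (D : 'I_n -> R) : \bar R :=
  let exponent := (fine p^-1 - fine q^-1)%R in
  ((2 `^ (1 - fine q^-1))%:E *
   maxe (\big[maxe/-oo]_(i < n) (fine (mu (O i)) `^ exponent)%:E)
        (\big[maxe/-oo]_(i < n) (D i)%:E))%E.

End sobolev.

(* Main.v *)
Require Import Defs.
From HB Require Import structures.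
From mathcomp Require Import all_boot all_order all_algebra.
From mathcomp Require Import all_classical all_reals all_analysis.
From mathcomp Require Import measurable_realfun ess_sup_inf.
From mathcomp Require Import ring lra.

Set Implicit Arguments.
Unset Strict Implicit.
Unset Printing Implicit Defensive.
Import Order.TTheory GRing.Theory Num.Theory.
Import numFieldNormedType.Exports.
Local Open Scope classical_set_scope.
Local Open Scope ring_scope.

(* On each piece O, write u = u_O + (u - u_O). By Hoelder,
   |u_O| |O|^(1/p) <= |O|^(1/p-1/q) ||u||_q, so that, with A the maximum in the
   constant, ||u||_p <= A (||u||_q + ||grad u||_q) on O. The pieces are glued by
   the inequality |x|_(l^p) <= |x|_(l^q) for the vector x of the local norms,
   and by (a + b)^q <= 2^(q-1) (a^q + b^q), whose q-th root yields the factor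
   2^(1-1/q). *)

(** * L^p norms over a subset, as norms of the extension by zero *)

Section Lnorm_restrict.
Context d (T : measurableType d) (R : realType).
Variable mu : {measure set T -> \bar R}.
Implicit Types (A B : set T) (u v : T -> R) (p q : \bar R).
Local Open Scope ereal_scope.

Local Notation N p A u := ('N[mu]_p[(EFin \o u) \_ A]).

Lemma measurable_normX A u (r : R) : measurable_fun A u ->
  measurable_fun A (EFin \o (fun x => `|u x| `^ r)%R).
Proof.
move=> mfu; apply/measurable_EFinP.
apply: (@measurableT_comp _ _ _ _ _ _ (@powR R ^~ r)) => //.
exact: measurableT_comp.
Qed.

(** Since 0 to a positive power is 0, the extension by zero contributes nothing off [A]. *)
Lemma Lnorm_restrict_EFin A u (r : R) : (0 < r)%R ->
  N r%:E A u = (\int[mu]_(x in A) (`|u x| `^ r)%:E) `^ r^-1.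
Proof.
move=> r0; rewrite unlock /Lnorm [in RHS]integral_mkcond; congr (_ `^ _).
apply: eq_integral => x _; rewrite !patchE; case: ifPn => //= _.
by rewrite normr0 powR0 ?gt_eqF.
Qed.

Lemma powR_Lnorm_restrict A u (r : R) : (0 < r)%R ->
  N r%:E A u `^ r = \int[mu]_(x in A) (`|u x| `^ r)%:E.
Proof.
move=> r0; rewrite Lnorm_restrict_EFin// -poweRrM mulVf ?gt_eqF// poweRe1//.
by apply: integral_ge0 => x _; rewrite lee_fin powR_ge0.
Qed.

(** The extension by zero stays below any nonnegative [y] off [A], so only the values on [A]
    matter. *)
Lemma Lnorm_restrict_yP A u (y : \bar R) : 0 <= y ->
  N +oo A u <= y <-> {ae mu, forall x, A x -> `|u x|%:E <= y}.
Proof.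
move=> y0; rewrite unlock /Lnorm; case: ifPn => [_|].
  split=> [/ess_supP|Ay]; last apply/ess_supP; last first.
    apply: filterS Ay => x Ay /=; rewrite patchE; case: ifPn => [|_].
      by rewrite inE => /Ay.
    by rewrite abse0.
  by apply: filterS => x /= + Ax; rewrite patchE mem_set.
(* If the whole space has measure 0, the norm is 0 by convention and every property holds almost
   everywhere. *)
rewrite -leNgt => mu0; split=> // _; exists setT; split=> //.
by apply/eqP; rewrite eq_le mu0 measure_ge0.
Qed.

Lemma Lnorm_restrict_ae A u : {ae mu, forall x, A x -> `|u x|%:E <= N +oo A u}.
Proof. by apply/(Lnorm_restrict_yP A u (Lnorm_ge0 mu _ _)). Qed.

Lemma Lnorm_restrictS p A B u : measurable A -> measurable B ->
  measurable_fun B u -> A `<=` B -> 1 <= p -> N p A u <= N p B u.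
Proof.
move=> mA mB mfu AB; case: p => [r|_|//].
  rewrite lee_fin => r1; have r0 : (0 < r)%R by exact: lt_le_trans r1.
  rewrite !Lnorm_restrict_EFin// gt0_ler_poweR ?invr_ge0 ?(ltW r0)//.
  - by rewrite in_itv/= leey integral_ge0// => x _; rewrite lee_fin powR_ge0.
  - by rewrite in_itv/= leey integral_ge0// => x _; rewrite lee_fin powR_ge0.
  - by apply: ge0_subset_integral => //; exact: measurable_normX.
apply/(Lnorm_restrict_yP A u (Lnorm_ge0 mu _ _)).
by apply: filterS (Lnorm_restrict_ae B u) => x + /AB.
Qed.

Lemma Lnorm_restrictD p A u v : measurable A -> measurable_fun A u ->
  measurable_fun A v -> 1 <= p ->
  N p A (u \+ v)%R <= N p A u + N p A v.
Proof.
move=> mA mfu mv p1; rewrite !restrict_EFin.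
rewrite (_ : (u \+ v)%R \_ A = (u \_ A \+ v \_ A)%R); last first.
  by apply/funext => x; rewrite /= !patchE; case: ifPn; rewrite ?addr0.
by apply: eminkowski => //; exact/(measurable_restrictT _ mA).
Qed.

(** Equality fails when [p] is [+oo] and [A] is null: the right side is then |c|, as 0 to the power
    0 is 1. The upper bound covers this case too. *)
Lemma Lnorm_restrict_cst p A (c : R) : measurable A -> mu A < +oo -> 1 <= p ->
  N p A (cst c) <= (`|c| * fine (mu A) `^ fine p^-1)%:E.
Proof.
move=> mA muA; have fA : mu A \is a fin_num by rewrite ge0_fin_numE.
case: p => [r|_|//].
  rewrite lee_fin => r1; have r0 : (0 < r)%R by exact: lt_le_trans r1.
  rewrite Lnorm_restrict_EFin// inver gt_eqF//=.
  rewrite (integral_cst _ _ (`|c| `^ r)%:E)// -(fineK fA) -EFinM poweR_EFin.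
  by rewrite powRM ?powR_ge0// -powRrM mulfV ?gt_eqF// powRr1.
apply: (proj2 (Lnorm_restrict_yP _ _ _)).
  by rewrite lee_fin mulr_ge0// powR_ge0.
by apply: aeW => x _; rewrite invey/= powRr0 mulr1.
Qed.

(** Hoelder's inequality for [u] against the constant 1 on [A]. The exponents 1 and [+oo] are
    treated apart, since [hoelder] is applied with two real conjugate exponents. *)
Lemma integral_le_Lnorm q A u : measurable A -> mu A < +oo ->
  measurable_fun A u -> 1 <= q ->
  \int[mu]_(x in A) `|u x|%:E <= (fine (mu A) `^ (1 - fine q^-1))%:E * N q A u.
Proof.
move=> mA muA mfu q1; have fA : mu A \is a fin_num by rewrite ge0_fin_numE.
have mnu : measurable_fun A (EFin \o (fun x => `|u x|)%R).
  by apply/measurable_EFinP; exact: measurableT_comp.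
case: q q1 => [r| |//]; last first.
  move=> _; rewrite invey subr0 powRr1 ?fine_ge0// fineK// muleC.
  rewrite -integral_cst//; apply: ae_ge0_le_integral => //.
  - by move=> x _; exact: Lnorm_ge0.
  - exact: Lnorm_restrict_ae.
rewrite lee_fin le_eqVlt => /predU1P[<-|r1].
  rewrite inve1 subrr powRr0 mul1e Lnorm_restrict_EFin// invr1 poweRe1.
    by under [leRHS]eq_integral do rewrite powRr1//.
  by apply: integral_ge0 => x _; rewrite lee_fin powR_ge0.
have r0 : (0 < r)%R by exact: lt_trans r1.
(* The exponent conjugate to [r], so that the norm of 1 over [A] is |A|^(1 - 1/r). *)
pose s := (1 - r^-1)^-1%R.
have s0 : (0 < s)%R by rewrite invr_gt0 subr_gt0 invf_lt1.
have rs : (r^-1 + s^-1 = 1)%R by rewrite /s invrK addrC subrK.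
have mr : measurable_fun [set: T] (u \_ A) by exact/(measurable_restrictT _ mA).
have m1 : measurable_fun [set: T] ((@cst T R 1%R) \_ A).
  exact/(measurable_restrictT _ mA).
have := hoelder mu mr m1 r0 s0 rs.
rewrite -!restrict_EFin Lnorm1 (_ : N s%:E A (@cst T R 1%R) =
    (fine (mu A) `^ (1 - fine r%:E^-1))%:E); last first.
  rewrite Lnorm_restrict_EFin// inver gt_eqF//= normr1 powR1.
  rewrite integral_cst// mul1e.
  by rewrite /s invrK -poweR_EFin fineK.
rewrite muleC; apply: le_trans.
rewrite integral_mkcond le_eqVlt; apply/predU1P; left.
by apply: eq_integral => x _; rewrite /= !patchE; case: ifPn;
  rewrite /= ?mulr1 ?mulr0 ?normr0.
Qed.

End Lnorm_restrict.

(** * Splitting a function into its mean and its deviation *)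

Section Lnorm_mean.
Context d (T : measurableType d) (R : realType).
Variable mu : {measure set T -> \bar R}.
Local Open Scope ereal_scope.

Local Notation N p A u := ('N[mu]_p[(EFin \o u) \_ A]).

(** The left side is at most |A|^(r - 1) times the integral of |u|, to which [integral_le_Lnorm]
    applies. It is used with r = 1/p, which is 0 when p is infinite. *)
Lemma mean_le_Lnorm q A (u : T -> R) (r : R) : measurable A -> mu A < +oo ->
  measurable_fun A u -> 1 <= q ->
  (`|(fine (mu A))^-1 * \int[mu]_(x in A) u x| * fine (mu A) `^ r)%:E <=
  (fine (mu A) `^ (r - fine q^-1))%:E * N q A u.
Proof.
move=> mA muA mfu q1.
have /orP[/eqP A0|A0] : (fine (mu A) == 0)%R || (0 < fine (mu A))%R.
- by rewrite -le0r fine_ge0.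
(* On a null set the mean is 0, because the inverse of 0 is 0. *)
- by rewrite A0 invr0 !mul0r normr0 mul0r mule_ge0// Lnorm_ge0.
rewrite normrM ger0_norm ?invr_ge0 ?(ltW A0)//.
rewrite mulrAC EFinM -powR_inv1 ?(ltW A0)// -powRD; last first.
  by rewrite (gt_eqF A0) implybT.
(* The exponent -1 + r comes from the mean and its weight, and 1 - 1/q from Hoelder. *)
have -> : (r - fine q^-1 = (-1 + r) + (1 - fine q^-1))%R.
  by ring.
rewrite [in leRHS]powRD; last by rewrite (gt_eqF A0) implybT.
rewrite [in leRHS]EFinM -muleA lee_wpmul2l ?lee_fin ?powR_ge0//.
apply: le_trans (integral_le_Lnorm mA muA mfu q1).
apply: (le_trans _ (le_abse_integral mu mA (proj2 (measurable_EFinP _ _) mfu))).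
rewrite /Rintegral; case: (\int[mu]_(x in A) _) => [s| |]//=.
(* An infinite integral has real value 0 by convention, so the bound is trivial. *)
- by rewrite normr0 leey.
- by rewrite normr0 leey.
Qed.

(** Minkowski's inequality for u = m + (u - m), where the constant m is controlled by
    [mean_le_Lnorm]. *)
Lemma Lnorm_le_mean_deviation p q A (u : T -> R) (m : R) :
  measurable A -> mu A < +oo -> measurable_fun A u -> 1 <= p -> 1 <= q ->
  m = ((fine (mu A))^-1 * \int[mu]_(x in A) u x)%R ->
  N p A u <= (fine (mu A) `^ (fine p^-1 - fine q^-1))%:E * N q A u +
             N p A (fun x => u x - m)%R.
Proof.
move=> mA muA mfu p1 q1 mE.
rewrite [in leLHS](_ : u = (cst m \+ (fun x => u x - m))%R); last first.
  by apply/funext => x /=; rewrite addrC subrK.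
apply: (le_trans (Lnorm_restrictD _ _ _ _ _)) => //.
  by apply: measurable_funB.
rewrite leeD2r// (le_trans (Lnorm_restrict_cst _ _ _ _))//.
by rewrite mE; exact: mean_le_Lnorm.
Qed.

End Lnorm_mean.

(** * Inequalities between l^p and l^q norms of finite vectors *)

Section finite_sums.
Context (R : realType).
Implicit Types p q : R.

(** The comparison of l^p with l^q at p infinite. *)
Lemma powR_le_sum n (x : 'I_n -> R) q i : (forall i, 0 <= x i) -> 0 < q ->
  x i <= (\sum_(j < n) x j `^ q) `^ q^-1.
Proof.
move=> x0 q0.
rewrite -[leLHS](@powRr1 _ (x i))// -(@mulfV _ q) ?gt_eqF// powRrM.
rewrite ge0_ler_powR ?invr_ge0 ?nnegrE ?powR_ge0 ?(ltW q0)//.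
  by rewrite sumr_ge0// => j _; exact: powR_ge0.
by rewrite (bigD1 i)//= lerDl sumr_ge0// => j _; exact: powR_ge0.
Qed.

(** With [s] the l^q norm, each x_i is at most s, so x_i^p = x_i^q x_i^(p-q) is at most x_i^q
    s^(p-q). Summing over i gives s^p. *)
Lemma powR_sum_le n (x : 'I_n -> R) p q : (forall i, 0 <= x i) ->
  0 < q -> q <= p ->
  (\sum_(i < n) x i `^ p) `^ p^-1 <= (\sum_(i < n) x i `^ q) `^ q^-1.
Proof.
move=> x0 q0 qp; have p0 : 0 < p by exact: lt_le_trans qp.
set s := leRHS.
have sq : s `^ q = \sum_(i < n) x i `^ q.
  rewrite -powRrM mulVf ?gt_eqF// powRr1// sumr_ge0// => i _.
  exact: powR_ge0.
have xs i : x i <= s by exact: powR_le_sum.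
have powE y : y `^ p = y `^ q * y `^ (p - q).
  by rewrite -powRD ?(addrC q) subrK// gt_eqF.
rewrite -[leRHS]powRr1 ?powR_ge0// -(@mulfV _ p) ?gt_eqF// powRrM.
rewrite ge0_ler_powR ?invr_ge0 ?nnegrE ?powR_ge0 ?(ltW p0)//.
  by rewrite sumr_ge0// => j _; exact: powR_ge0.
rewrite powE sq mulr_suml; apply: ler_sum => i _.
by rewrite powE ler_wpM2l ?powR_ge0// ge0_ler_powR ?subr_ge0 ?nnegrE ?powR_ge0.
Qed.

(** Convexity of the q-th power at a + b, the midpoint of 2a and 2b. *)
Lemma powRD_le (a b q : R) : 0 <= a -> 0 <= b -> 1 <= q ->
  (a + b) `^ q <= 2 `^ (q - 1) * (a `^ q + b `^ q).
Proof.
move=> a0 b0 q1; have q0 : 0 < q by exact: lt_le_trans q1.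
have i0 : (0 : R) <= 2^-1 by rewrite invr_ge0.
have i1 : (2^-1 : R) <= 1 by rewrite invf_le1 ?ler1n.
have : (2^-1 * (2 * a) + (1 - 2^-1) * (2 * b)) `^ q <=
    2^-1 * (2 * a) `^ q + (1 - 2^-1) * (2 * b) `^ q.
  by apply: (convex_powR q1 (Itv01 i0 i1));
    rewrite inE/= in_itv/= andbT mulr_ge0.
have -> : (1 - 2^-1 : R) = 2^-1 by rewrite [X in X - _](splitr 1) div1r addrK.
rewrite !mulKf// => /le_trans; apply.
rewrite -mulrDr !powRM// -mulrDr mulrA -powR_inv1//.
rewrite -powRD ?pnatr_eq0 ?implybT//.
by rewrite addrC.
Qed.

(** Each term is bounded by [powRD_le]. Taking the q-th root then turns the factor 2^(q-1) into
    2^(1-1/q). *)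
Lemma powR_sumM_le n (a b : 'I_n -> R) (A q : R) :
  (forall i, 0 <= a i) -> (forall i, 0 <= b i) -> 0 <= A -> 1 <= q ->
  (\sum_(i < n) (A * (a i + b i)) `^ q) `^ q^-1 <=
  2 `^ (1 - q^-1) * A *
    (\sum_(i < n) a i `^ q + \sum_(i < n) b i `^ q) `^ q^-1.
Proof.
move=> a0 b0 A0 q1; have q0 : 0 < q by exact: lt_le_trans q1.
have S0 (c : 'I_n -> R) : 0 <= \sum_(i < n) c i `^ q.
  by rewrite sumr_ge0// => i _; exact: powR_ge0.
set c := _ * A; have c0 : 0 <= c by rewrite mulr_ge0// powR_ge0.
have cq : c `^ q = A `^ q * 2 `^ (q - 1).
  by rewrite powRM ?powR_ge0// -powRrM mulrBl mul1r mulVf ?gt_eqF// mulrC.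
rewrite -[c](@powRr1 _ c)// -(@mulfV _ q) ?gt_eqF// powRrM -powRM ?powR_ge0//.
  rewrite ge0_ler_powR ?invr_ge0 ?nnegrE ?mulr_ge0 ?powR_ge0 ?addr_ge0//;
    first exact: ltW.
  rewrite -big_split/= mulr_sumr; apply: ler_sum => i _.
  by rewrite powRM ?addr_ge0// cq -mulrA ler_wpM2l ?powR_ge0// powRD_le.
by rewrite addr_ge0.
Qed.

End finite_sums.

(** * Gluing norms over disjoint pieces that cover up to a null set *)

Section almost_partition.
Context d (T : measurableType d) (R : realType).
Variable mu : {measure set T -> \bar R}.
Variables (n : nat) (Omega : set T) (F : 'I_n -> set T).
Hypotheses (mOmega : measurable Omega) (mF : forall i, measurable (F i)).
Hypothesis dF : forall i j, i != j -> F i `&` F j = set0.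
Hypothesis FOmega : forall i, F i `<=` Omega.
Hypothesis Omega0 : mu (Omega `\` \bigcup_i F i) = 0%E.
Local Open Scope ereal_scope.

Local Notation N p A u := ('N[mu]_p[(EFin \o u) \_ A]).

Lemma ge0_integral_almost_partition (f : T -> \bar R) :
  measurable_fun Omega f -> (forall x, Omega x -> 0 <= f x) ->
  \int[mu]_(x in Omega) f x = \sum_(i < n) \int[mu]_(x in F i) f x.
Proof.
move=> mf f0.
have UF : \bigcup_i F i = \big[setU/set0]_(i < n) F i.
  rewrite -bigcup_seq; congr (\bigcup_(i in _) _).
  by apply/seteqP; split => // i _ /=; rewrite mem_index_enum.
have mU : measurable (\bigcup_i F i).
  by rewrite UF; exact: bigsetU_measurable.
(* Removing the uncovered null set from [Omega] leaves exactly the disjoint union of the pieces. *)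
rewrite (ge0_negligible_integral _ _ _ _ Omega0)//; last exact: measurableD.
have -> : Omega `\` (Omega `\` \bigcup_i F i) = \bigcup_i F i.
  by rewrite setDD; apply/setIidr => x [i _ /FOmega].
have FU : \bigcup_i F i `<=` Omega by move=> x [i _ /FOmega].
rewrite UF ge0_integral_bigsetU//.
- exact: index_enum_uniq.
- move=> i j _ _ [x [Fi Fj]]; apply/eqP/negPn/negP => ij.
  by have : (F i `&` F j) x by []; rewrite dF.
- by rewrite -UF; exact: measurable_funS mf.
- by move=> x; rewrite -UF => /FU; exact: f0.
Qed.

(** The exceptional set is a finite union of null sets: one for each piece, and the uncovered part
    of [Omega]. *)
Lemma Lnorm_restrict_y_le_cover (u : T -> R) (y : \bar R) : 0 <= y ->
  (forall i, N +oo (F i) u <= y) -> N +oo Omega u <= y.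
Proof.
move=> y0 Fy; apply/(Lnorm_restrict_yP mu _ _ y0).
have FA : \forall x \ae mu, forall i, F i x -> `|u x|%:E <= y.
  by apply: filter_forall => i; apply/(Lnorm_restrict_yP mu _ _ y0).
have : \forall x \ae mu, Omega x -> (\bigcup_i F i) x.
  exists (Omega `\` \bigcup_i F i); split=> //.
    apply: measurableD => //; apply: fin_bigcup_measurable => //.
  by move=> x /= /not_implyP.
by apply: filterS2 FA => x Fx + Ox => /(_ Ox)[i _ /Fx].
Qed.

Lemma powR_Lnorm_almost_partition (u : T -> R) (r : R) :
  measurable_fun Omega u -> (0 < r)%R ->
  N r%:E Omega u `^ r = \sum_(i < n) N r%:E (F i) u `^ r.
Proof.
move=> mfu r0; rewrite powR_Lnorm_restrict//.
under [RHS]eq_bigr do rewrite powR_Lnorm_restrict//.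
apply: ge0_integral_almost_partition.
  exact: measurable_normX.
by move=> x _; rewrite lee_fin powR_ge0.
Qed.

(** For finite p the norm on [Omega] is the l^p norm of the local norms, hence at most that of [y],
    and [powR_sum_le] passes to l^q. For infinite p each y_i is at most the l^q norm of [y]. *)
Lemma Lnorm_le_almost_partition (p : \bar R) (q : R) (u : T -> R)
    (y : 'I_n -> R) : measurable_fun Omega u -> (0 < q)%R -> q%:E <= p ->
  (forall i, 0 <= y i)%R -> (forall i, N p (F i) u <= (y i)%:E) ->
  N p Omega u <= ((\sum_(i < n) y i `^ q) `^ q^-1)%:E.
Proof.
move=> mfu q0 qp y0 uy; case: p qp uy => [s| |//].
  rewrite lee_fin => qs uy; have s0 : (0 < s)%R by exact: lt_le_trans qs.
  apply: (@le_trans _ _ ((\sum_(i < n) y i `^ s) `^ s^-1)%:E); last first.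
    by rewrite lee_fin powR_sum_le.
  have -> : N s%:E Omega u = (N s%:E Omega u `^ s) `^ s^-1.
    by rewrite -poweRrM mulfV ?gt_eqF// poweRe1// Lnorm_ge0.
  rewrite -poweR_EFin gt0_ler_poweR ?invr_ge0 ?(ltW s0)//.
  - by rewrite in_itv/= leey poweR_ge0.
  - rewrite in_itv/= leey lee_fin sumr_ge0// => i _; exact: powR_ge0.
  rewrite powR_Lnorm_almost_partition// -sumEFin; apply: lee_sum => i _.
  rewrite -poweR_EFin gt0_ler_poweR ?(ltW s0)//.
  - by rewrite in_itv/= leey Lnorm_ge0.
  - by rewrite in_itv/= leey lee_fin y0.
move=> _ uy; apply: Lnorm_restrict_y_le_cover.
  by rewrite lee_fin powR_ge0.
by move=> i; apply: (le_trans (uy i)); rewrite lee_fin powR_le_sum.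
Qed.

End almost_partition.

(** * Finite measure of bounded sets, and restriction of Sobolev functions *)

Section euclidean_space.
Context (R : realType) (N : nat).
Local Notation V := 'rV[R]_N.
Local Notation mu := (@lebesgue_rV R N).
Implicit Types (S : set V) (u phi : V -> R) (Du : V -> V).

Lemma le_coord_norm (v : V) i : `|v ord0 i| <= `|v|.
Proof.
rewrite [leRHS]/Num.Def.normr/= mx_normrE.
exact: (le_bigmax _ (fun ij : 'I_1 * 'I_N => `|v ij.1 ij.2|) (ord0, i)).
Qed.

(** Each coordinate is bounded by the norm, so a bounded set lies in a cube [-M, M]^N, whose volume
    is finite. *)
Lemma bounded_lebesgue_lty S : measurable S -> bounded_set S -> (mu S < +oo)%E.
Proof.
move=> mS /pinfty_ex_gt0[M M0 SM].
pose a : V := const_mx (- M); pose b : V := const_mx M.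
pose box : set V := [set v : V | forall i, a ord0 i <= v ord0 i <= b ord0 i].
have boxE : mu box = (\prod_(i < N) (b ord0 i - a ord0 i))%:E.
  by apply: lebesgue_rV_box => i; rewrite !mxE; lra.
have mbox : measurable box.
  rewrite (_ : box = [set v : V | forall i, `[- M, M]%classic (v ord0 i)]).
    exact: (@measurable_pi _ _ (fun=> `[- M, M]%classic)).
  by apply/seteqP; split => v /= + i => /(_ i); rewrite in_itv/= !mxE.
apply: (@le_lt_trans _ _ (mu box)); last by rewrite boxE ltry.
apply: le_measure; rewrite ?inE// => v Sv i; rewrite !mxE -ler_norml.
by apply: le_trans (le_coord_norm v i) _; exact: SM.
Qed.

Lemma test_functionS S S' phi : S `<=` S' -> test_function S phi ->
  test_function S' phi.
Proof.
by move=> SS' [Ckphi cphi sphi]; split => //; exact: subset_trans SS'.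
Qed.

Lemma notin_supp phi x : ~ supp phi x -> phi x = 0.
Proof.
by move=> sx; apply/eqP/negPn/negP => px; apply: sx; exact: subset_closure.
Qed.

Lemma partial_notin_supp phi i x : ~ supp phi x -> partial i phi x = 0.
Proof.
move=> sx; rewrite /partial (@near_eq_derive _ _ _ _ (cst 0)).
  by rewrite derive_cst.
(* The support is closed, so [phi] vanishes on a neighbourhood of [x], not only at [x]. *)
have : nbhs x (~` supp phi).
  by apply: open_nbhs_nbhs; split=> //; exact/closed_openC/closed_closure.
by apply: filterS => y; exact: notin_supp.
Qed.

(** This transfers both sides of the weak gradient identity from a set to a subset. *)
Lemma Rintegral_supp S S' (f : V -> R) phi : S `<=` S' -> supp phi `<=` S ->
  (forall x, ~ supp phi x -> f x = 0) ->
  \int[mu]_(x in S') f x = \int[mu]_(x in S) f x.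
Proof.
move=> SS' pS f0; rewrite Rintegral_mkcond [RHS]Rintegral_mkcond.
apply: eq_Rintegral => x _; rewrite !patchE.
have [/set_mem Sx|/negP Sx] := boolP (x \in S).
  by rewrite mem_set//; exact: SS'.
by case: ifPn => // _; apply: f0 => /pS; rewrite -in_setE.
Qed.

Lemma locally_integrable_onS S S' u : measurable S' -> S `<=` S' ->
  measurable S ->
  locally_integrable_on S' u -> locally_integrable_on S u.
Proof.
move=> mS' SS' mS [mfu iu]; split; first exact: measurable_funS mfu.
by move=> K cK KS; apply: iu => //; exact: subset_trans SS'.
Qed.

Lemma in_LpS S S' p u : measurable S -> measurable S' -> S `<=` S' ->
  (1 <= p)%E -> in_Lp S' p u -> in_Lp S p u.
Proof.
move=> mS mS' SS' p1 [mfu uoo]; split; first exact: measurable_funS mfu.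
by apply: le_lt_trans uoo; exact: Lnorm_restrictS.
Qed.

(** A test function on [S] is also one on [S'], and both integrals in the identity see only its
    support. Hence the same [Du] serves on the subset. *)
Lemma sobolevS S S' q u Du : measurable S -> measurable S' -> S `<=` S' ->
  (1 <= q)%E -> sobolev S' q u Du -> sobolev S q u Du.
Proof.
move=> mS mS' SS' q1 [uq [iu iDu wu] Duq]; split.
- exact: in_LpS uq.
- split => [|i|phi i tphi].
  + exact: locally_integrable_onS iu.
  + exact: locally_integrable_onS (iDu i).
  + have [_ _ sphi] := tphi.
    have := wu phi i (test_functionS SS' tphi).
    rewrite (Rintegral_supp SS' sphi) => [->|x sx].
      congr (- _); apply: (Rintegral_supp SS' sphi) => x sx.
      by rewrite notin_supp ?mulr0.
    by rewrite partial_notin_supp ?mulr0.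
- exact: in_LpS Duq.
Qed.

End euclidean_space.

(** * The embedding estimate with its explicit constant *)

Theorem theorem3p1 (R : realType) (N : nat) (Omega : set 'rV[R]_N)
    (p q : \bar R) (n : nat) (Omega_ : 'I_n -> set 'rV[R]_N) (D : 'I_n -> R) :
  (0 < N)%N ->
  domain Omega -> bounded_set Omega ->
  (1 <= q)%E -> (q <= p)%E ->
  (forall i, domain (Omega_ i)) -> (forall i, bounded_set (Omega_ i)) ->
  closure Omega = \bigcup_i closure (Omega_ i) ->
  (forall i j, i != j -> Omega_ i `&` Omega_ j = set0) ->
  (* The Omega_ i partition Omega up to a null set. *)
  (forall i, Omega_ i `<=` Omega) ->
  lebesgue_rV N (Omega `\` \bigcup_i Omega_ i) = 0%E ->
  (forall i u Du, sobolev (Omega_ i) q u Du ->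
    (Lp_norm (Omega_ i) p (fun x => u x - mean (Omega_ i) u)%R <=
     (D i)%:E * Lp_norm (Omega_ i) q (euclidean_norm \o Du))%E) ->
  forall u Du, sobolev Omega q u Du ->
    (Lp_norm Omega p u <=
     embedding_constant p q Omega_ D * sobolev_norm Omega q u Du)%E.
Proof.
move=> _ [[x0 Ox0] _ oO] _ q1 qp dOm bOm clO disj sub null hD u Du Sob.
have p1 : (1 <= p)%E by exact: le_trans qp.
have mO : measurable Omega by exact: open_measurable_rV.
have mOm i : measurable (Omega_ i).
  by have [_ _] := dOm i; exact: open_measurable_rV.
have mu_lty i : (lebesgue_rV N (Omega_ i) < +oo)%E.
  by apply: bounded_lebesgue_lty => //; exact: bOm.
(* A point of [Omega] lies in the closure of some piece, so there is at least one piece and the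
   maxima are not [-oo]. *)
have [i0 _] : (\bigcup_i closure (Omega_ i)) x0.
  by rewrite -clO; exact: subset_closure.
move=> {Ox0} _.
have [[mfu uoo] wu [mDu Duoo]] := Sob.
rewrite /embedding_constant/=.
set e := (fine p^-1%E - fine q^-1%E)%R.
set C := maxe _ _.
have C_lty : (C < +oo)%E.
  by rewrite /C gt_max; apply/andP; split; apply: bigmax_lt => // i _;
    rewrite ltry.
have KC i : ((fine (lebesgue_rV N (Omega_ i)) `^ e)%:E <= C)%E.
  by rewrite /C le_max le_bigmax.
have DC i : ((D i)%:E <= C)%E by rewrite /C le_max le_bigmax orbT.
(* No sign is assumed for the [D i]: nonnegativity comes from the power of the measure of piece
   [i0]. *)
have C0 : (0 <= C)%E by apply: le_trans (KC i0); rewrite lee_fin powR_ge0.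
have [A CE] : exists A, C = A%:E.
  by exists (fine C); rewrite fineK// ge0_fin_numE.
rewrite CE -EFinM.
have A0 : 0 <= A by rewrite -lee_fin -CE.
set g := euclidean_norm \o Du in mDu Duoo *.
(* The local estimate: [C] dominates both the coefficient of the mean and that of the deviation. *)
have piece i : (Lp_norm (Omega_ i) p u <=
    A%:E * (Lp_norm (Omega_ i) q u + Lp_norm (Omega_ i) q g))%E.
  have mui : measurable_fun (Omega_ i) u by exact: measurable_funS mfu.
  have := Lnorm_le_mean_deviation (mOm i) (mu_lty i) mui p1 q1 erefl.
  move=> /le_trans; apply.
  rewrite ge0_muleDr ?Lnorm_ge0// leeD//.
    by rewrite lee_wpmul2r ?Lnorm_ge0// -CE; exact: KC.
  apply: (le_trans (hD i u Du _)); first exact: sobolevS Sob.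
  by rewrite lee_wpmul2r ?Lnorm_ge0// -CE; exact: DC.
have leO v i : measurable_fun Omega v ->
    (Lp_norm (Omega_ i) q v <= Lp_norm Omega q v)%E.
  by move=> mv; exact: Lnorm_restrictS.
case: q => [r| |//]
  in q1 qp hD Sob uoo Duoo e C C_lty KC DC C0 CE piece leO *; last first.
  (* Infinite q forces infinite p, and the prefactor of [A] is then 2. *)
  move: qp; rewrite leye_eq => /eqP p_oo.
  rewrite invey/= subr0 powRr1// /sobolev_norm.
  rewrite p_oo in piece *.
  apply: (Lnorm_restrict_y_le_cover mO mOm null).
    by rewrite mule_ge0 ?adde_ge0 ?Lnorm_ge0// lee_fin mulr_ge0.
  move=> i; apply: (le_trans (piece i)); apply: lee_pmul => //.
  - by rewrite adde_ge0 ?Lnorm_ge0.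
  (* The sup norms already give the constant [A], which is at most [2 * A]. *)
  - by rewrite lee_fin; nra.
  - by rewrite leeD// leO.
have r1 : 1 <= r by rewrite -lee_fin.
have r0 : 0 < r by exact: lt_le_trans r1.
(* For finite q the local norms are finite, so the gluing can be carried out with real numbers. *)
have fin v i : measurable_fun Omega v -> (Lp_norm Omega r%:E v < +oo)%E ->
    ((fine (Lp_norm (Omega_ i) r%:E v))%:E = Lp_norm (Omega_ i) r%:E v)%E.
  move=> mv voo; rewrite fineK// ge0_fin_numE ?Lnorm_ge0//.
  exact: le_lt_trans (leO v i mv) voo.
pose a i := fine (Lp_norm (Omega_ i) r%:E u).
pose b i := fine (Lp_norm (Omega_ i) r%:E g).
have aE i : (a i)%:E = Lp_norm (Omega_ i) r%:E u by exact: fin.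
have bE i : (b i)%:E = Lp_norm (Omega_ i) r%:E g by exact: fin.
have a0 i : 0 <= a i by rewrite fine_ge0// Lnorm_ge0.
have b0 i : 0 <= b i by rewrite fine_ge0// Lnorm_ge0.
have normE v c : measurable_fun Omega v ->
    (forall i, (c i)%:E = Lp_norm (Omega_ i) r%:E v) ->
    (\int[lebesgue_rV N]_(x in Omega) (`|v x| `^ r)%:E)%E =
    (\sum_(i < n) c i `^ r)%:E.
  move=> mv cE; rewrite -powR_Lnorm_restrict//.
  rewrite (powR_Lnorm_almost_partition mO mOm disj sub null)// -sumEFin.
  by apply: eq_bigr => i _; rewrite -poweR_EFin cE.
have -> : sobolev_norm Omega r%:E u Du =
    ((\sum_(i < n) a i `^ r + \sum_(i < n) b i `^ r) `^ r^-1)%:E.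
  rewrite /sobolev_norm (normE u a)//.
  have := normE g b mDu bE.
  (* The Sobolev norm has no absolute value around the Euclidean norm, which is nonnegative. *)
  under eq_integral do rewrite ger0_norm ?sqrtr_ge0//.
  by move=> ->; rewrite -EFinD poweR_EFin.
rewrite -EFinM inver gt_eqF//=.
(* Gluing with the local bounds A (a_i + b_i) comes first; [powR_sumM_le] then separates the two
   families. *)
apply: le_trans (_ : ((\sum_(i < n) (A * (a i + b i)) `^ r) `^ r^-1)%:E <= _)%E.
  apply: (Lnorm_le_almost_partition mO mOm disj sub null) => // i.
    by rewrite mulr_ge0// addr_ge0.
  by rewrite EFinM EFinD aE bE; exact: piece.
by rewrite lee_fin powR_sumM_le.
Qed.
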